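(* Let $(C,\Omega)$ be a shellable chain complex of order $d$ over a principal ring $R$. For $0\leq i\leq d$, every $i$-skeleton $\operatorname{sk}_i(C)$ of $C$ is shellable.
   Context: A principal ring $R$ is an integral domain (commutative with $1$) all of whose ideals are principal. **Chain complexes.** A chain complex $(C,\Omega)$ over $R$ consists of free $R$-modules $C_\nu$ ($\nu\geq 0$), each with a fixed finite (possibly empty) basis $\Omega_\nu$, and $R$-linear maps $\partial_\nu\colon C_\nu\to C_{\nu-1}$ ($\nu\geq1$), $\partial_0\colon C_0\to 0$, with $\partial_\nu\circ\partial_{\nu+1}=0$; $\Omega=\bigcup_\nu\Omega_\nu$. It is finite of order $d$ if $C_\nu=0$ for $\nu>d$ and $C_d\neq0$. For $x=\sum_i a_ie^\nu_i\in C_\nu$ (with $e^\nu_i\in\Omega_\nu$), $\operatorname{supp}(x)=\{e^\nu_i\mid a_i\neq0\}$ and $\operatorname{bd}(x)=\operatorname{supp}(\partial_\nu x)$. The $i$-skeleton $\operatorname{sk}_i(C)$ is the subcomplex with chain modules $C_\nu$ (basis $\Omega_\nu$) for $0\leq\nu\leq i$ and $0$ for $\nu>i$. A finite complex of order $d$ is pure if every $e\in\Omega_\nu$, $0\leq\nu\leq d-1$, lies in $\operatorname{bd}(f)$ for some $f\in\Omega_{\nu+1}$. A basis element is maximal if it lies in $\operatorname{bd}(f)$ for no $f\in\Omega$; $\Gamma$ is the set of all maximal basis elements. For $e\in\Omega_\mu$ the subcomplex $(C_e,\Omega_e)$ has bases $(\Omega_e)_\nu=\emptyset$ for $\nu>\mu$,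 $(\Omega_e)_\mu=\{e\}$, and $(\Omega_e)_\nu=\bigcup_{f\in(\Omega_e)_{\nu+1}}\operatorname{bd}(f)$ for $0\leq\nu\leq\mu-1$. Put $s(e)=\mu$. A subset $T\subset\Omega$ such that $\Omega_e\subset T$ for all $e\in T$ generates the subcomplex with basis $T$; $T_\nu=T\cap\Omega_\nu$. **Shellings** (recursive in $d$). Let $(C,\Omega)$ be finite of order $d$ with $\Gamma\neq\emptyset$. An order $g_1,\ldots,g_k$ of the elements of $\Gamma$ is a shelling if $d=0$, or if $d\geq1$ and: (S1) for $2\leq j\leq k$ the set $\Omega_{g_j}\cap\bigcup_{i=1}^{j-1}\Omega_{g_i}$ generates a pure chain complex of order $s(g_j)-1$; (S2) for $2\leq j\leq k$ the set $(\Omega_{g_j})_{s(g_j)-1}$ has a shelling in which the elements of $\bigl(\Omega_{g_j}\cap\bigcup_{i=1}^{j-1}\Omega_{g_i}\bigr)_{s(g_j)-1}$ come first; (S3) $(\Omega_{g_1})_{s(g_1)-1}$ has a shelling. Here (S1), (S2) are regarded as satisfied when $s(g_j)=0$, and for $s(g)\geq1$ a shelling of $(\Omega_g)_{s(g)-1}=\operatorname{bd}(g)$ means a shelling of $\operatorname{sk}_{s(g)-1}(C_g)$, whose maximal elements are exactly the elements of $\operatorname{bd}(g)$. $(C,\Omega)$ is shellable if a shelling exists. *)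

(* Defs.v *)
From HB Require Import structures.
From mathcomp Require Import all_boot all_order all_algebra.

Set Implicit Arguments.
Unset Strict Implicit.
Unset Printing Implicit Defensive.

Import GRing.Theory.

Local Open Scope ring_scope.

(* Ideals are Prop-valued so that all of them are covered, not only the
   decidable ones. *)
Definition is_ideal (R : comNzRingType) (I : R -> Prop) : Prop :=
  [/\ I 0,
      forall x y, I x -> I y -> I (x + y)
    & forall a x, I x -> I (a * x)].

Definition principal_ring (R : idomainType) : Prop :=
  forall I : R -> Prop, is_ideal I ->
    exists a : R, forall x : R, I x <-> exists b : R, x = b * a.

(* The free module with finite basis B is {ffun B -> R^o}: a chain is its
   family of coefficients. The map from degree n.+1 to degree n is
   [boundary n]; the zero map out of degree 0 is left implicit. *)
Record chain_complex (R : nzRingType) := ChainComplex {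
  basis : nat -> finType;
  boundary : forall n : nat,
    {linear {ffun basis n.+1 -> R^o} -> {ffun basis n -> R^o}};
  boundaryK : forall (n : nat) (x : {ffun basis n.+2 -> R^o}),
    boundary n (boundary n.+1 x) = 0 }.

Definition chain (R : nzRingType) (C : chain_complex R) (n : nat) :=
  {ffun basis C n -> R^o}.

Definition gen (R : nzRingType) (C : chain_complex R) (n : nat)
    (e : basis C n) : chain C n :=
  [ffun e' => (e' == e)%:R].

Definition supp (R : nzRingType) (C : chain_complex R) (n : nat)
    (x : chain C n) : {set basis C n} :=
  [set e | x e != 0].

(* The disjoint union Omega of the bases. *)
Definition cell (R : nzRingType) (C : chain_complex R) : Type :=
  {n : nat & basis C n}.

Definition deg (R : nzRingType) (C : chain_complex R) (e : cell C) : nat :=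
  tag e.

Definition mk_cell (R : nzRingType) (C : chain_complex R) (n : nat)
    (e : basis C n) : cell C :=
  Tagged (fun n => basis C n : Type) e.

Definition bd_at (R : nzRingType) (C : chain_complex R) (n : nat) :
    basis C n -> seq (cell C) :=
  match n with
  | 0 => fun=> [::]
  | m.+1 => fun f : basis C m.+1 =>
      [seq mk_cell e | e <- enum (supp (C := C) (boundary C m (gen f)))]
  end.

Definition bd (R : nzRingType) (C : chain_complex R) (f : cell C) :
    seq (cell C) :=
  bd_at (tagged f).

Definition maximal (R : nzRingType) (C : chain_complex R) (e : cell C) : Prop :=
  forall f : cell C, e \notin bd f.

Definition has_order (R : nzRingType) (C : chain_complex R) (d : nat) : Prop :=
  (forall n, (d < n)%N -> forall x : chain C n, x = 0)
  /\ (exists x : chain C d, x <> 0).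

Definition pure_of_order (R : nzRingType) (C : chain_complex R) (d : nat) :
    Prop :=
  has_order C d
  /\ (forall e : cell C, (deg e < d)%N ->
        exists2 f : cell C, deg f = (deg e).+1 & e \in bd f).

(* [faces e k] lists the part of Omega_e in degree deg e - k. *)
Fixpoint faces (R : nzRingType) (C : chain_complex R) (e : cell C) (k : nat) :
    seq (cell C) :=
  match k with
  | 0 => [:: e]
  | k'.+1 => flatten [seq bd f | f <- faces e k']
  end.

Definition Omega_of (R : nzRingType) (C : chain_complex R) (e : cell C) :
    pred (cell C) :=
  [pred x | (deg x <= deg e)%N && (x \in faces e (deg e - deg x))].

Definition closed_cells (R : nzRingType) (C : chain_complex R)
    (T : pred (cell C)) : Prop :=
  forall e x : cell C, T e -> Omega_of e x -> T x.

Lemma deg_bd (R : nzRingType) (C : chain_complex R) (e f : cell C) :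
  e \in bd f -> deg f = (deg e).+1.
Proof. by case: f => [[|m] f] //= /mapP[x _ ->]. Qed.

Lemma Omega_of_bd (R : nzRingType) (C : chain_complex R) (e f : cell C) :
  e \in bd f -> Omega_of f e.
Proof.
move=> ef; rewrite /Omega_of /= (deg_bd ef) leqnSn /= subSnn /=.
by rewrite cats0.
Qed.

Lemma faces_bd (R : nzRingType) (C : chain_complex R) (e x y : cell C) k :
  x \in faces e k -> y \in bd x -> y \in faces e k.+1.
Proof.
by move=> xk yx; apply/flattenP; exists (bd x) => //; apply: map_f.
Qed.

Lemma faces_trans (R : nzRingType) (C : chain_complex R) (e x y : cell C) k l :
  x \in faces e k -> y \in faces x l -> y \in faces e (k + l).
Proof.
move=> xk; elim: l y => [|l IHl] y /=.
  by rewrite inE addn0 => /eqP->.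
case/flattenP=> _ /mapP[z zl ->] yz.
by rewrite addnS; apply: faces_bd (IHl _ zl) yz.
Qed.

Lemma closed_Omega_of (R : nzRingType) (C : chain_complex R) (e : cell C) :
  closed_cells (Omega_of e).
Proof.
move=> x y /= /andP[xe xF] /andP[yx yF]; apply/andP; split.
  exact: leq_trans yx xe.
have -> : (deg e - deg y = (deg e - deg x) + (deg x - deg y))%N.
  by rewrite addnBA // subnK.
exact: faces_trans xF yF.
Qed.

Lemma closedI (R : nzRingType) (C : chain_complex R) (S T : pred (cell C)) :
  closed_cells S -> closed_cells T -> closed_cells (predI S T).
Proof.
move=> cS cT e x /= /andP[Se Te] xe.
by rewrite (cS _ _ Se xe) (cT _ _ Te xe).
Qed.

(* The union of the Omega_g, g in s. *)
Definition Omega_of_seq (R : nzRingType) (C : chain_complex R)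
    (s : seq (cell C)) : pred (cell C) :=
  [pred x | has (fun g => Omega_of g x) s].

Lemma closed_Omega_of_seq (R : nzRingType) (C : chain_complex R)
    (s : seq (cell C)) :
  closed_cells (Omega_of_seq s).
Proof.
move=> e x /= /hasP[g gs eg] xe; apply/hasP; exists g => //.
exact: closed_Omega_of eg xe.
Qed.

Definition skel_cells (R : nzRingType) (C : chain_complex R) (i : nat) :
    pred (cell C) :=
  [pred e | (deg e <= i)%N].

Lemma closed_skel_cells (R : nzRingType) (C : chain_complex R) (i : nat) :
  closed_cells (@skel_cells R C i).
Proof. by move=> e x /= ei /andP[xe _]; apply: leq_trans xe ei. Qed.

(* The subcomplex generated by a closed set T: the boundary of a chain on T is
   computed in C, after extension by zero, and restricted to T again. *)
Definition sub_basis (R : nzRingType) (C : chain_complex R)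
    (T : pred (cell C)) (n : nat) : finType :=
  {e : basis C n | T (mk_cell e)}.

Definition ext0 (R : nzRingType) (C : chain_complex R)
    (T : pred (cell C)) (n : nat) (x : {ffun sub_basis T n -> R^o}) :
    {ffun basis C n -> R^o} :=
  [ffun e => oapp x 0 (insub e)].

Definition restr (R : nzRingType) (C : chain_complex R)
    (T : pred (cell C)) (n : nat) (x : {ffun basis C n -> R^o}) :
    {ffun sub_basis T n -> R^o} :=
  [ffun u => x (val u)].

Lemma ext0_is_linear (R : nzRingType) (C : chain_complex R)
    (T : pred (cell C)) (n : nat) :
  linear (@ext0 R C T n).
Proof.
move=> a x y; apply/ffunP=> e; rewrite !ffunE.
by case: insub => [u|] /=; rewrite ?ffunE // scaler0 addr0.
Qed.

HB.instance Definition _ (R : nzRingType) (C : chain_complex R)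
    (T : pred (cell C)) (n : nat) :=
  GRing.isLinear.Build R {ffun sub_basis T n -> R^o} {ffun basis C n -> R^o}
    *:%R (@ext0 R C T n) (@ext0_is_linear R C T n).

Lemma restr_is_linear (R : nzRingType) (C : chain_complex R)
    (T : pred (cell C)) (n : nat) :
  linear (@restr R C T n).
Proof. by move=> a x y; apply/ffunP=> e; rewrite !ffunE. Qed.

HB.instance Definition _ (R : nzRingType) (C : chain_complex R)
    (T : pred (cell C)) (n : nat) :=
  GRing.isLinear.Build R {ffun basis C n -> R^o} {ffun sub_basis T n -> R^o}
    *:%R (@restr R C T n) (@restr_is_linear R C T n).

Definition sub_boundary (R : nzRingType) (C : chain_complex R)
    (T : pred (cell C)) (n : nat) :
    {linear {ffun sub_basis T n.+1 -> R^o} -> {ffun sub_basis T n -> R^o}} :=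
  @restr R C T n \o boundary C n \o @ext0 R C T n.+1.

Lemma chain_gen (R : nzRingType) (C : chain_complex R) (n : nat)
    (x : chain C n) :
  x = \sum_e x e *: gen e.
Proof.
apply/ffunP=> e; rewrite sum_ffunE (bigD1 e) //= big1 => [|e' ne].
  by rewrite addr0 !ffunE eqxx /= /GRing.scale /= mulr1.
by rewrite !ffunE eq_sym (negbTE ne) scaler0.
Qed.

Lemma boundary_ext0 (R : nzRingType) (C : chain_complex R)
    (T : pred (cell C)) (n : nat) (x : {ffun sub_basis T n.+1 -> R^o}) :
  closed_cells T ->
  ext0 (restr T (boundary C n (ext0 x))) = boundary C n (ext0 x).
Proof.
move=> cT; apply/ffunP=> e; rewrite ffunE.
case: insubP => [u _ <-|Te] /=; first by rewrite ffunE.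
rewrite [ext0 x](@chain_gen R C) linear_sum sum_ffunE big1 // => f _.
rewrite linearZ ffunE [ext0 x f]ffunE.
case: insubP => [u Tu uf|_] /=; last by rewrite scale0r.
suff /eqP-> : boundary C n (gen f) e == 0 by rewrite scaler0.
apply: contraNT Te => Bfe; apply: cT Tu _; apply: Omega_of_bd.
by apply/mapP; exists e; rewrite ?mem_enum ?inE.
Qed.

Lemma sub_boundaryK (R : nzRingType) (C : chain_complex R)
    (T : pred (cell C)) (cT : closed_cells T) (n : nat)
    (x : {ffun sub_basis T n.+2 -> R^o}) :
  sub_boundary T n (sub_boundary T n.+1 x) = 0.
Proof. by rewrite /sub_boundary /= boundary_ext0 // boundaryK linear0. Qed.

Definition subcomplex (R : nzRingType) (C : chain_complex R)
    (T : pred (cell C)) (cT : closed_cells T) : chain_complex R :=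
  ChainComplex (sub_boundaryK cT).

Definition sub_cell (R : nzRingType) (C : chain_complex R)
    (T : pred (cell C)) (cT : closed_cells T)
    (e : cell (subcomplex cT)) : cell C :=
  mk_cell (val (tagged e : sub_basis T (tag e))).

Definition sk (R : nzRingType) (C : chain_complex R) (i : nat) :
    chain_complex R :=
  subcomplex (@closed_skel_cells R C i).

Definition cell_complex (R : nzRingType) (C : chain_complex R) (e : cell C) :
    chain_complex R :=
  subcomplex (@closed_Omega_of R C e).

(* For deg e >= 1, the complex whose shellings are by definition the shellings
   of (Omega_e)_{deg e - 1} = bd e. *)
Definition bd_complex (R : nzRingType) (C : chain_complex R) (e : cell C) :
    chain_complex R :=
  sk (cell_complex e) (deg e).-1.

Definition bd_cell (R : nzRingType) (C : chain_complex R) (e : cell C)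
    (h : cell (bd_complex e)) : cell C :=
  sub_cell (sub_cell h).

Definition meet_cells (R : nzRingType) (C : chain_complex R) (e : cell C)
    (l : seq (cell C)) : pred (cell C) :=
  predI (Omega_of e) (Omega_of_seq l).

Definition meet_complex (R : nzRingType) (C : chain_complex R) (e : cell C)
    (l : seq (cell C)) : chain_complex R :=
  subcomplex (closedI (@closed_Omega_of R C e) (@closed_Omega_of_seq R C l)).

(* g is a listing without repetition of the set of all maximal cells, which is
   moreover nonempty. *)
Definition maximal_order (R : nzRingType) (C : chain_complex R)
    (g : seq (cell C)) : Prop :=
  [/\ g <> [::], uniq g & forall e : cell C, e \in g <-> maximal e].

(* A decomposition g = l ++ x :: r with l <> [::] picks x = g_j with j >= 2 and
   l = [:: g_1; ...; g_(j-1)]. The required shelling of bd x starting with the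
   cells of bd x met earlier is h1 ++ h2, where h1 lists exactly those cells.
   When deg x = 0 there is no bd x to shell and nothing is asked of x; for
   x = g_1 in a complex of order >= 1 this case cannot occur anyway, since the
   first g_j of degree >= 1 would then have an empty meet_complex.
   The recursion is well founded since the order drops at each step. *)
Inductive shelling (R : nzRingType) (C : chain_complex R) (g : seq (cell C)) :
    Prop :=
| Shelling0 of has_order C 0 & maximal_order g
| ShellingS (d : nat) of has_order C d.+1 & maximal_order g
    & (forall l x r, g = l ++ x :: r -> l <> [::] -> (0 < deg x)%N ->
        pure_of_order (meet_complex x l) (deg x).-1)
    & (forall l x r, g = l ++ x :: r -> l <> [::] -> (0 < deg x)%N ->
        exists h1 h2 : seq (cell (bd_complex x)),
          shelling (h1 ++ h2)
          /\ (forall h : cell (bd_complex x), h \in h1 <->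
                deg h = (deg x).-1 /\ meet_cells x l (bd_cell h)))
    & (forall x r, g = x :: r -> (0 < deg x)%N ->
        exists h : seq (cell (bd_complex x)), shelling h).

Definition shellable (R : nzRingType) (C : chain_complex R) : Prop :=
  exists g : seq (cell C), shelling g.

(* Main.v *)
Require Import Defs.
From mathcomp Require Import all_boot all_order all_algebra.

Set Implicit Arguments.
Unset Strict Implicit.
Unset Printing Implicit Defensive.

Import GRing.Theory.

(** It suffices to go down one dimension: if the [d.+1]-skeleton has order
    [d.+1] and a shelling [g], then the [d]-skeleton has order [d] and a
    shelling.

    The new shelling keeps the cells of [g] of degree at most [d] in place. A
    cell [x] of [g] of degree [d.+1], met after the cells [l], comes with a
    shelling [h1 ++ h2] of [bd x], where [h1] lists the cells of [bd x] that lie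
    in the part generated by [l]; [x] is replaced by [h2]. The list [l'] built
    from a prefix [l] of [g] consists of exactly the cells generated by [l]
    which are maximal in the [d]-skeleton, so [l'] generates the same cells of
    degree at most [d] as [l]. Hence a kept cell meets what precedes it in the
    same cells as before. A cell [z] of [h2], say [h2 = m ++ z :: r], meets
    [l' ++ m] exactly as it meets [h1 ++ m]: since the intersection of [x] with
    [l] is pure of order [d], it is generated by [h1]. So what is required of
    [z] is part of the statement that [h1 ++ h2] is a shelling of [bd x]. This
    is [skeleton_prefix], from which [shelling_skelS] follows.

    The recursive definition of a shelling passes from a complex to subcomplexes
    of subcomplexes, whose cells have types of their own. To compare them, all
    conditions are restated for a set [T] of cells of one fixed complex
    ([shelling_on]); [embeds_shelling] transports shellings along an embedding
    of cells that preserves degrees and boundaries. *)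

(** * Shellings of sets of cells *)

Section Relative.
Variables (R : nzRingType) (C : chain_complex R).
Implicit Types (T : pred (cell C)) (e f x y : cell C) (g l h : seq (cell C)).

Definition order_on T (d : nat) : Prop :=
  (forall e, T e -> deg e <= d) /\ (exists2 e, T e & deg e = d).

Definition maximal_on T e : Prop := T e /\ forall f, T f -> e \notin bd f.

Definition maximal_order_on T g : Prop :=
  [/\ g <> [::], uniq g & forall e, e \in g <-> maximal_on T e].

Definition pure_on T (d : nat) : Prop :=
  order_on T d
  /\ (forall e, T e -> deg e < d -> exists2 f, T f & e \in bd f).

Definition below x : pred (cell C) :=
  [pred y | Omega_of x y && (deg y <= (deg x).-1)].

(** The condition on a cell [x] of a shelling preceded by the cells [l]. For
    [l = [::]] the list [h1] is forced to be empty, so that the clause on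
    [h1 ++ h2] just says that [bd x] has a shelling: the condition on the first
    cell needs no separate treatment. The recursion is abstracted in
    [bd_shelling]. *)
Definition attaches (bd_shelling : seq (cell C) -> Prop) l x : Prop :=
  0 < deg x ->
    (l <> [::] -> pure_on (meet_cells x l) (deg x).-1)
    /\ (exists h1 h2, bd_shelling (h1 ++ h2)
         /\ forall y, y \in h1 <-> deg y = (deg x).-1 /\ meet_cells x l y).

(** In order [0] the conditions on the cells are void, as all cells have degree
    [0]; hence a single constructor. *)
Inductive shelling_on T g : Prop :=
| ShellingOn (d : nat) of order_on T d & maximal_order_on T g
    & (forall l x r, g = l ++ x :: r -> attaches (shelling_on (below x)) l x).

Lemma meet_cellsE x l y : meet_cells x l y = Omega_of x y && Omega_of_seq l y.
Proof. by []. Qed.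

Lemma Omega_of_seqE l y : Omega_of_seq l y = has (fun e => Omega_of e y) l.
Proof. by []. Qed.

Lemma belowE x y : below x y = Omega_of x y && (deg y <= (deg x).-1).
Proof. by []. Qed.

Lemma Omega_of_refl x : Omega_of x x.
Proof. by rewrite /Omega_of /= leqnn subnn /= inE. Qed.

Lemma Omega_of_deg x y : Omega_of x y -> deg y <= deg x.
Proof. by case/andP. Qed.

Lemma Omega_of_trans x y z : Omega_of x y -> Omega_of y z -> Omega_of x z.
Proof. exact: closed_Omega_of. Qed.

Lemma Omega_of_eq_deg x y : Omega_of x y -> deg y = deg x -> y = x.
Proof. by case/andP=> _ + exy; rewrite exy subnn /= inE => /eqP. Qed.

Lemma deg_faces e k x : x \in faces e k -> deg e = deg x + k.
Proof.
elim: k x => [|k IHk] x /=; first by rewrite inE addn0 => /eqP->.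
case/flattenP=> _ /mapP[f fk ->] /deg_bd ef.
by rewrite (IHk _ fk) ef addSnnS.
Qed.

Lemma Omega_of_faces e k x : x \in faces e k -> Omega_of e x.
Proof.
by move=> xk; rewrite /Omega_of /= (deg_faces xk) leq_addr addKn.
Qed.

Lemma Omega_of_coface x y :
  Omega_of x y -> y = x \/ exists2 f, Omega_of x f & y \in bd f.
Proof.
case/andP=> _; case: (deg x - deg y) => [|k] /=.
  by rewrite inE => /eqP; left.
case/flattenP=> _ /mapP[f fk ->] yf; right; exists f => //.
exact: Omega_of_faces fk.
Qed.

Lemma Omega_of_face x y :
  Omega_of x y -> deg y < deg x -> exists2 f, f \in bd x & Omega_of f y.
Proof.
case/andP=> _; move: (deg x - deg y) => k.
elim: k y => [|k IHk] y /=; first by rewrite inE => /eqP->; rewrite ltnn.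
case/flattenP=> _ /mapP[f fk ->] yf _.
have [fx|] := ltnP (deg f) (deg x).
  have [e ex fe] := IHk _ fk fx; exists e => //.
  exact: Omega_of_trans fe (Omega_of_bd yf).
move=> xf; have Of := Omega_of_faces fk.
have fx : f = x.
  apply: (Omega_of_eq_deg Of); apply/eqP.
  by rewrite eqn_leq xf (Omega_of_deg Of).
by exists y; [rewrite -fx | apply: Omega_of_refl].
Qed.

(** Purity only provides cofaces; climbing along them reaches the top degree. *)
Lemma pure_on_top T d y : pure_on T d -> T y ->
  exists2 f, T f & deg f = d /\ Omega_of f y.
Proof.
case=> [[dT _] pT]; move en: (d - deg y) => n.
elim: n y en => [|n IHn] y en Ty.
  exists y => //; split; last exact: Omega_of_refl.
  by apply/eqP; rewrite eqn_leq dT //= -subn_eq0 en.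
have [f Tf yf] := pT _ Ty ltac:(by rewrite -subn_gt0 en).
have [|k Tk [dk kf]] := IHn f _ Tf.
  by rewrite (deg_bd yf) subnS en.
exists k => //; split=> //; exact: Omega_of_trans kf (Omega_of_bd yf).
Qed.

Lemma order_on_ext T T' d : T =1 T' -> order_on T d -> order_on T' d.
Proof.
move=> eT [dT [e Te ed]]; split; last by exists e; rewrite -?eT.
by move=> f; rewrite -eT; apply: dT.
Qed.

Lemma pure_on_ext T T' d : T =1 T' -> pure_on T d -> pure_on T' d.
Proof.
move=> eT [oT pT]; split; first exact: order_on_ext oT.
move=> e; rewrite -eT => Te /(pT _ Te)[f Tf ef].
by exists f; rewrite -?eT.
Qed.

Lemma attaches_ext S l l' x :
    (l = [::] <-> l' = [::]) -> meet_cells x l =1 meet_cells x l' ->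
  attaches S l x -> attaches S l' x.
Proof.
move=> nl ml alx /alx[pl [h1 [h2 [Sh mh]]]]; split.
  by move=> nl'; apply: pure_on_ext ml (pl _) => /nl.
by exists h1, h2; split=> // y; rewrite -ml.
Qed.

End Relative.

(** * Embeddings of cell sets *)

Section Embedding.
Variables (R : nzRingType).
Implicit Types (C D E : chain_complex R).

Record embeds D C (phi : cell D -> cell C) (T : pred (cell C)) : Prop :=
  Embeds {
    embeds_inj : injective phi;
    embeds_deg : forall e, deg (phi e) = deg e;
    embeds_bd : forall f, bd (phi f) =i map phi (bd f);
    embeds_onto : forall y, T y <-> exists e, y = phi e }.

Lemma embeds_id C (T : pred (cell C)) : (forall e : cell C, T e) -> embeds id T.
Proof.
move=> allT; split=> // [f e|y]; first by rewrite map_id.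
by split=> // _; exists y.
Qed.

Lemma embeds_comp C D E (psi : cell E -> cell D) (phi : cell D -> cell C)
    (S : pred (cell D)) (T U : pred (cell C)) :
    embeds psi S -> embeds phi T ->
    (forall y, U y <-> exists2 x, S x & y = phi x) ->
  embeds (phi \o psi) U.
Proof.
move=> epsi ephi defU; split.
- exact: inj_comp (embeds_inj ephi) (embeds_inj epsi).
- by move=> e; rewrite /= (embeds_deg ephi) (embeds_deg epsi).
- move=> f e; rewrite /= (embeds_bd ephi) map_comp.
  by apply: eq_mem_map; apply: embeds_bd epsi f.
move=> y; split=> [/defU[x /(embeds_onto epsi)[e ->] ->]|[e ->]].
  by exists e.
by apply/defU; exists (psi e) => //; apply/(embeds_onto epsi); exists e.
Qed.

Lemma ext0_gen C (T : pred (cell C)) (cT : closed_cells T) n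
    (f : sub_basis T n) :
  ext0 (gen (C := subcomplex cT) f) = gen (val f).
Proof.
apply/ffunP=> e; rewrite !ffunE; case: insubP => [u _ <-|] /=.
  by rewrite ffunE.
by case: eqP => // -> /negP[]; apply: (valP f).
Qed.

Lemma embeds_sub_cell C (T : pred (cell C)) (cT : closed_cells T) :
  embeds (@sub_cell R C T cT) T.
Proof.
split.
- move=> [m e] [n f] ef.
  have emn : m = n by move/(congr1 (@tag _ _)): ef.
  case: n / emn f ef => f ef.
  by have /val_inj-> : val (e : sub_basis T m) = val f := eq_from_Tagged ef.
- by [].
- case=> [[|n] f] e; first by [].
  have suppE (u : sub_basis T n) :
      (u \in supp (boundary (subcomplex cT) n (gen f)))
        = (val u \in supp (boundary C n (gen (val f)))).
    by rewrite !inE ffunE /= ext0_gen.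
  apply/mapP/mapP=> [[y]|[_ /mapP[u + ->] ->]]; last first.
    by rewrite mem_enum suppE => uf; exists (val u); rewrite ?mem_enum.
  rewrite mem_enum => yf ->.
  have Ty : T (mk_cell y).
    apply: (cT (mk_cell (val f)) _ (valP f)); apply: Omega_of_bd.
    by apply/mapP; exists y; rewrite ?mem_enum.
  exists (mk_cell (C := subcomplex cT) (Sub y Ty : sub_basis T n)) => //.
  by apply: map_f; rewrite mem_enum suppE.
move=> y; split=> [Ty|[[n e] ->]]; last exact: valP (e : sub_basis T n).
case: y Ty => n y Ty.
by exists (mk_cell (C := subcomplex cT) (Sub y Ty : sub_basis T n)).
Qed.

Section Transport.
Variables (C D : chain_complex R) (phi : cell D -> cell C) (T : pred (cell C)).
Hypothesis ephi : embeds phi T.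

Lemma embeds_deg_le d : order_on T d -> forall e : cell D, deg e <= d.
Proof.
move=> [dT _] e; rewrite -(embeds_deg ephi) dT //.
by apply/(embeds_onto ephi); exists e.
Qed.

Lemma embeds_lift (s : seq (cell C)) :
  (forall y, y \in s -> T y) -> exists s', s = map phi s'.
Proof.
elim: s => [|y s IHs] sT; first by exists [::].
have [|s' ->] := IHs; first by move=> z zs; apply: sT; rewrite inE zs orbT.
have /(embeds_onto ephi)[x ->] := sT y (mem_head _ _).
by exists (x :: s').
Qed.

Lemma embeds_mem_bd e f : (phi e \in bd (phi f)) = (e \in bd f).
Proof. by rewrite (embeds_bd ephi) mem_map //; apply: embeds_inj ephi. Qed.

Lemma embeds_faces e k : faces (phi e) k =i map phi (faces e k).
Proof.
elim: k => [|k IHk] y //=; apply/flattenP/mapP.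
  case=> _ /mapP[f + ->]; rewrite IHk => /mapP[x xk ->].
  rewrite (embeds_bd ephi) => /mapP[z zx ->]; exists z => //.
  exact: faces_bd xk zx.
case=> x /flattenP[_ /mapP[f fk ->] xf ->]; exists (bd (phi f)).
  by apply: map_f; rewrite IHk map_f.
by rewrite embeds_mem_bd.
Qed.

Lemma embeds_Omega_of e x : Omega_of (phi e) (phi x) = Omega_of e x.
Proof.
rewrite /Omega_of /= !(embeds_deg ephi) embeds_faces mem_map //.
exact: embeds_inj ephi.
Qed.

Lemma embeds_Omega_of_inv e y :
  Omega_of (phi e) y -> exists2 x, Omega_of e x & y = phi x.
Proof.
case/andP=> _; rewrite embeds_faces => /mapP[x xk ->]; exists x => //.
exact: Omega_of_faces xk.
Qed.

Lemma embeds_meet_cells x l y :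
  meet_cells (phi x) (map phi l) (phi y) = meet_cells x l y.
Proof.
rewrite !meet_cellsE !Omega_of_seqE embeds_Omega_of has_map; congr (_ && _).
by apply: eq_has => g; rewrite [LHS]embeds_Omega_of.
Qed.

Lemma embeds_maximal e : maximal e <-> maximal_on T (phi e).
Proof.
split=> [me|[_ me] f].
  split=> [|f /(embeds_onto ephi)[x ->]]; last by rewrite embeds_mem_bd.
  by apply/(embeds_onto ephi); exists e.
rewrite -embeds_mem_bd; apply: me.
by apply/(embeds_onto ephi); exists f.
Qed.

Lemma embeds_maximal_order g :
  maximal_order g <-> maximal_order_on T (map phi g).
Proof.
have nilE : g = [::] <-> map phi g = [::] by case: g.
have inE' e : (phi e \in map phi g) = (e \in g).
  by rewrite mem_map //; apply: embeds_inj ephi.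
rewrite /maximal_order_on map_inj_uniq; last exact: embeds_inj ephi.
split=> -[ng ug mg]; split=> //; try by move/nilE.
  move=> y; split=> [/mapP[e eg ->]|my].
    by apply/embeds_maximal/mg.
  have [/(embeds_onto ephi)[e ye] _] := my.
  by rewrite ye in my *; rewrite inE'; apply/mg/embeds_maximal.
move=> e; rewrite -inE'.
exact: iff_trans (mg _) (iff_sym (embeds_maximal e)).
Qed.

Lemma embeds_order d : has_order D d <-> order_on T d.
Proof.
have gen_neq0 n (b : basis D n) : gen b <> 0%R.
  by move/ffunP/(_ b); rewrite !ffunE eqxx => /eqP; rewrite oner_eq0.
split=> [[dD [x x_neq0]]|[dT [_ /(embeds_onto ephi)[[n b] ->]]]].
  split=> [_ /(embeds_onto ephi)[[n b] ->]|].
    rewrite (embeds_deg ephi) leqNgt; apply/negP=> dn.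
    exact: gen_neq0 (dD _ dn (gen b)).
  have [/existsP[b _]|/existsPn x0] := boolP [exists b, x b != 0%R].
    exists (phi (mk_cell b)); last by rewrite (embeds_deg ephi).
    by apply/(embeds_onto ephi); exists (mk_cell b).
  by case: x_neq0; apply/ffunP=> b; rewrite ffunE; apply/eqP/negPn/x0.
rewrite (embeds_deg ephi) /deg /= => nd; subst n.
split; last by exists (gen b); apply: gen_neq0.
move=> n dn x; apply/ffunP=> b'; suff: n <= d by rewrite leqNgt dn.
rewrite -[n](embeds_deg ephi (mk_cell b')) dT //.
by apply/(embeds_onto ephi); exists (mk_cell b').
Qed.

Lemma embeds_pure d : pure_of_order D d <-> pure_on T d.
Proof.
split=> -[/embeds_order oD pD]; split=> //.
  move=> _ /(embeds_onto ephi)[e ->]; rewrite (embeds_deg ephi) => /pD[f _ ef].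
  exists (phi f); last by rewrite embeds_mem_bd.
  by apply/(embeds_onto ephi); exists f.
move=> e; rewrite -[deg e](embeds_deg ephi) => ed.
have [|_ /(embeds_onto ephi)[f ->]] := pD _ _ ed.
  by apply/(embeds_onto ephi); exists e.
rewrite embeds_mem_bd (embeds_deg ephi) => ef.
by exists f => //; apply: deg_bd.
Qed.

End Transport.

Lemma embeds_meet_complex C D (phi : cell D -> cell C) T x l :
    embeds phi T ->
  embeds (phi \o @sub_cell R D _ (closedI (@closed_Omega_of R D x)
                                          (@closed_Omega_of_seq R D l)))
         (meet_cells (phi x) (map phi l)).
Proof.
move=> ephi; apply: (embeds_comp (embeds_sub_cell _) ephi) => y.
split=> [my|[z mz ->]]; last by rewrite (embeds_meet_cells ephi).
have /andP[/(embeds_Omega_of_inv ephi)[z _ yz] _] := my.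
have mz : meet_cells x l z by rewrite -(embeds_meet_cells ephi) -yz.
by exists z.
Qed.

Lemma embeds_bd_cell C (x : cell C) : embeds (@bd_cell R C x) (below x).
Proof.
apply: (embeds_comp (embeds_sub_cell _) (embeds_sub_cell _)) => y.
split=> [/andP[xy yx]|[[n [b xb]] yx ->]].
  have /(embeds_onto (embeds_sub_cell (@closed_Omega_of R C x)))[z yz] := xy.
  by exists z => //; rewrite yz (embeds_deg (embeds_sub_cell _)) in yx.
by apply/andP; split; first exact: xb.
Qed.

Lemma embeds_below C D (phi : cell D -> cell C) T x :
  embeds phi T -> embeds (phi \o @bd_cell R D x) (below (phi x)).
Proof.
move=> ephi; apply: (embeds_comp (embeds_bd_cell x) ephi) => y.
split=> [/andP[/(embeds_Omega_of_inv ephi)[z xz ->]]|[z xz ->]].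
  by rewrite !(embeds_deg ephi) => zx; exists z => //; apply/andP.
by rewrite /below /= !(embeds_deg ephi) (embeds_Omega_of ephi).
Qed.

Lemma map_eq_cat (A B : Type) (f : A -> B) g l y r :
    map f g = l ++ y :: r ->
  exists l' x r', [/\ g = l' ++ x :: r', l = map f l', y = f x & r = map f r'].
Proof.
elim: l g => [|z l IHl] [|x g] //= [].
  by move=> <- <-; exists [::], x, g.
by move=> <- /IHl[l' [x' [r' [-> -> -> ->]]]]; exists (x :: l'), x', r'.
Qed.

(** The two constructors of [shelling], and the conditions on the first and on
    the later cells, merge for the reasons given at [attaches] and
    [shelling_on]. *)
Lemma shellingP D (g : seq (cell D)) :
  shelling g <-> exists d,
    [/\ has_order D d, maximal_order g
      & forall l x r, g = l ++ x :: r -> 0 < deg x ->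
        (l <> [::] -> pure_of_order (meet_complex x l) (deg x).-1)
        /\ (exists h1 h2 : seq (cell (bd_complex x)), shelling (h1 ++ h2)
             /\ forall h : cell (bd_complex x), h \in h1 <->
                  deg h = (deg x).-1 /\ meet_cells x l (bd_cell h))].
Proof.
have idD : embeds id (fun _ : cell D => true) by apply: embeds_id.
have degD d (e : cell D) : has_order D d -> deg e <= d.
  by move/(embeds_order idD)/(embeds_deg_le idD).
split=> [[oD mg|d oD mg S1 S2 S3]|[[|d] [oD mg S]]].
- exists 0; split=> // l x r _ x_gt0.
  by have := degD _ x oD; rewrite leqNgt x_gt0.
- exists d.+1; split=> // l x r gE x_gt0.
  split=> [l_neq0|]; first exact: S1 gE l_neq0 x_gt0.
  case: l gE => [|y l] gE; last exact: S2 gE _ x_gt0.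
  have [h hS] := S3 _ _ gE x_gt0; exists [::], h; split=> // y.
  by split=> // -[_ /andP[]].
- exact: Shelling0.
apply: ShellingS oD mg _ _ _ => [l x r gE l_neq0|l x r gE l_neq0|x r gE] x_gt0.
- by have [+ _] := S _ _ _ gE x_gt0; apply.
- by have [] := S _ _ _ gE x_gt0.
by have [_ [h1 [h2 [hS _]]]] := S [::] _ _ gE x_gt0; exists (h1 ++ h2).
Qed.

(** The induction is on a bound for the degrees: the cells of [bd_complex x]
    have degree less than [deg x], and [bd_complex x] embeds in [C] through
    [D]. *)
Lemma embeds_shelling_bounded n C D (phi : cell D -> cell C) T g :
    embeds phi T -> (forall e : cell D, deg e <= n) ->
  shelling g <-> shelling_on T (map phi g).
Proof.
elim: n C D phi T g => [|n IHn] C D phi T g ephi degD.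
  split.
    case/shellingP=> d.
    case=> /(embeds_order ephi) oT /(embeds_maximal_order ephi) mT _.
    apply: (ShellingOn (d := d)) => // l' x' r' gE'.
    have [l [x [r [_ -> -> _]]]] := map_eq_cat gE'.
    by rewrite /attaches (embeds_deg ephi) ltnNge degD.
  case=> d /(embeds_order ephi) oD /(embeds_maximal_order ephi) mD _.
  by apply/shellingP; exists d; split=> // l x r _; rewrite ltnNge degD.
have degB (x : cell D) (h : cell (bd_complex x)) : deg h <= n.
  rewrite -(embeds_deg (embeds_bd_cell x)).
  have /andP[_ le_h] : below x (bd_cell h).
    by apply/(embeds_onto (embeds_bd_cell x)); exists h.
  apply: leq_trans le_h _; rewrite -ltnS; have := degD x.
  by case: (deg x).
have IH (x : cell D) h := IHn _ _ _ _ h (embeds_below x ephi) (@degB x).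
split.
  case/shellingP=> d.
  case=> /(embeds_order ephi) oT /(embeds_maximal_order ephi) mT S.
  apply: (ShellingOn (d := d)) => // l' x' r' gE'.
  have [l [x [r [gE -> -> _]]]] := map_eq_cat gE'.
  rewrite /attaches (embeds_deg ephi) => x_gt0.
  have [pl [h1 [h2 [hS mh]]]] := S _ _ _ gE x_gt0; split.
    move=> l_neq0; apply/(embeds_pure (embeds_meet_complex x l ephi))/pl.
    by move=> l0; rewrite l0 in l_neq0.
  set psi := phi \o @bd_cell R D x in IH.
  exists (map psi h1), (map psi h2); split; first by rewrite -map_cat; apply/IH.
  move=> y; split=> [/mapP[h /mh[dh mlh] ->]|[dy my]].
    rewrite (embeds_deg (embeds_below x ephi)) dh; split=> //.
    by rewrite /psi /= (embeds_meet_cells ephi).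
  have /(embeds_onto (embeds_below x ephi))[h yh] : below (phi x) y.
    by case/andP: my => xy _; rewrite belowE xy (embeds_deg ephi) dy leqnn.
  rewrite yh; apply: map_f; apply/mh.
  rewrite -(embeds_deg (embeds_below x ephi)) -yh; split=> //.
  by rewrite yh (embeds_meet_cells ephi) in my.
case=> d /(embeds_order ephi) oD /(embeds_maximal_order ephi) mD S.
apply/shellingP; exists d; split=> // l x r gE x_gt0.
have := S (map phi l) (phi x) (map phi r); rewrite gE map_cat => /(_ erefl).
rewrite /attaches (embeds_deg ephi) => /(_ x_gt0)[pl [k1 [k2 [kS mk]]]]; split.
  move=> l_neq0; apply/(embeds_pure (embeds_meet_complex x l ephi))/pl.
  by move=> l0; case: (l) l0 l_neq0.
have kB y : y \in k1 ++ k2 -> below (phi x) y.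
  by case: kS => ? _ [_ _ mk12] _ /mk12[].
have [|h1 k1E] := embeds_lift (embeds_below x ephi) (s := k1).
  by move=> y yk; apply: kB; rewrite mem_cat yk.
have [|h2 k2E] := embeds_lift (embeds_below x ephi) (s := k2).
  by move=> y yk; apply: kB; rewrite mem_cat yk orbT.
exists h1, h2; split; first by apply/IH; rewrite map_cat -k1E -k2E.
move=> h; rewrite -(embeds_deg (embeds_below x ephi)).
rewrite -(embeds_meet_cells ephi); apply: iff_trans (mk _).
by rewrite k1E mem_map //; apply: embeds_inj (embeds_below x ephi).
Qed.

Lemma embeds_shelling C D (phi : cell D -> cell C) T g :
  embeds phi T -> shelling g <-> shelling_on T (map phi g).
Proof.
move=> ephi; split=> gS.
  have /shellingP[d [/(embeds_order ephi) oT _ _]] := gS.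
  exact/(embeds_shelling_bounded g ephi (embeds_deg_le ephi oT)).
have [d oT _ _] := gS.
exact/(embeds_shelling_bounded g ephi (embeds_deg_le ephi oT)).
Qed.

End Embedding.

(** * From one skeleton to the next lower one *)

Lemma cat_eq_cat_cons (A : Type) (s t l r : seq A) x :
    s ++ t = l ++ x :: r ->
  (exists r', s = l ++ x :: r') \/ (exists2 m, l = s ++ m & t = m ++ x :: r).
Proof.
elim: s l => [|y s IHs] [|z l] /=; try by right; exists [::].
- by right; exists (z :: l).
- by case=> <- _; left; exists s.
by case=> <- /IHs[[r' ->]|[m -> ->]]; [left; exists r' | right; exists m].
Qed.

Section Skeleton.
Variables (R : nzRingType) (C : chain_complex R).
Implicit Types (e f x y : cell C) (g l h : seq (cell C)).

Notation skel := (@skel_cells R C).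

Lemma skelE d y : skel d y = (deg y <= d).
Proof. by []. Qed.

Lemma Omega_of_seq_cat l l' y :
  Omega_of_seq (l ++ l') y = Omega_of_seq l y || Omega_of_seq l' y.
Proof. by rewrite !Omega_of_seqE has_cat. Qed.

Lemma Omega_of_seq_rcons l x y :
  Omega_of_seq (rcons l x) y = Omega_of_seq l y || Omega_of x y.
Proof. by rewrite -cats1 Omega_of_seq_cat !Omega_of_seqE /= orbF. Qed.

Lemma Omega_of_seq_mem l y : y \in l -> Omega_of_seq l y.
Proof.
move=> yl; rewrite Omega_of_seqE; apply/hasP; exists y => //.
exact: Omega_of_refl.
Qed.

Lemma maximal_on_skel d y : deg y = d -> maximal_on (skel d) y.
Proof.
move=> yd; split=> [|f]; rewrite skelE ?yd // => fd; apply/negP=> /deg_bd yf.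
by rewrite yf yd ltnn in fd.
Qed.

Lemma maximal_on_skelS d y :
  maximal_on (skel d.+1) y -> deg y <= d -> maximal_on (skel d) y.
Proof.
by move=> [_ my] yd; split=> // f fd; apply: my; rewrite skelE leqW.
Qed.

Lemma maximal_on_Omega_of d x y :
  Omega_of x y -> deg x <= d -> maximal_on (skel d) y -> y = x.
Proof.
move=> xy xd [_ my]; case: (Omega_of_coface xy) => [//|[f xf yf]].
by have := my f (leq_trans (Omega_of_deg xf) xd); rewrite yf.
Qed.

Lemma Omega_of_uncovered_deg d x y :
    Omega_of x y -> deg x = d.+1 -> deg y <= d ->
    (forall f, Omega_of x f -> deg f <= d -> y \notin bd f) ->
  deg y = d.
Proof.
move=> xy dx yd my; case: (Omega_of_coface xy) => [yx|[f xf yf]].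
  by rewrite yx dx ltnn in yd.
have [fd|fd] := leqP (deg f) d; first by have := my f xf fd; rewrite yf.
suff : (deg y).+1 = d.+1 by case.
by apply/eqP; rewrite -(deg_bd yf) eqn_leq fd -dx Omega_of_deg.
Qed.

(** The membership condition on the list [l'] replacing the prefix [l] of a
    shelling: among lists without repetition it determines [l'] up to order, and
    it suffices for [l] and [l'] to generate the same cells of degree at most
    [d] ([skeleton_order_Omega]). *)
Definition skeleton_order d l l' : Prop :=
  forall y, y \in l' <-> Omega_of_seq l y /\ maximal_on (skel d) y.

Section Step.
Variables (d : nat) (g : seq (cell C)).
Hypothesis (og : order_on (skel d.+1) d.+1).
Hypothesis (gS : shelling_on (skel d.+1) g).

(** The last clause excludes [bd x = [::]]: a cell of degree [d.+1] without
    boundary would leave nothing to replace it in degree [d]. It holds because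
    the maximal cells listed in a shelling are required to exist. *)
Lemma top_bd_shelling l x r : g = l ++ x :: r -> deg x = d.+1 ->
  exists h1 h2,
   [/\ shelling_on (below x) (h1 ++ h2),
       forall y, y \in h1 ++ h2 <-> Omega_of x y /\ deg y = d,
       forall y, y \in h1 <-> deg y = d /\ meet_cells x l y
     & h1 ++ h2 <> [::]].
Proof.
move=> gE dx; case: gS => _ _ _ /(_ _ _ _ gE); rewrite /attaches dx /=.
case=> // _ [h1 [h2 [hS mh1]]]; exists h1, h2; split=> //.
  have mh : forall y, y \in h1 ++ h2 <-> maximal_on (below x) y.
    by case: hS => _ _ [].
  move=> y; split=> [/mh[]|[xy yd]].
    rewrite belowE dx /= => /andP[xy yd] my; split=> //.
    apply: (Omega_of_uncovered_deg xy dx yd) => f xf fd.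
    by apply: my; rewrite belowE dx xf.
  apply/mh; split=> [|f]; first by rewrite belowE dx xy yd /=.
  rewrite belowE dx => /andP[_ fd]; apply/negP=> /deg_bd fy.
  by rewrite fy yd ltnn in fd.
by case: hS => _ _ [].
Qed.

Lemma skeleton_order_Omega l r l' y : g = l ++ r -> skeleton_order d l l' ->
  Omega_of_seq l' y = Omega_of_seq l y && (deg y <= d).
Proof.
move=> gE ml'; apply/idP/andP=> [/hasP[z /ml'[lz [zd _]] zy]|[]].
  split; first exact: closed_Omega_of_seq lz zy.
  exact: leq_trans (Omega_of_deg zy) zd.
case/hasP=> x xl xy yd.
have mx : maximal_on (skel d.+1) x.
  by case: gS => _ _ [_ _ mg] _; apply/mg; rewrite gE mem_cat xl.
have [xd|xd] := leqP (deg x) d.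
  apply/hasP; exists x => //; apply/ml'; split; first exact: Omega_of_seq_mem.
  exact: maximal_on_skelS.
have dx : deg x = d.+1 by apply/eqP; rewrite eqn_leq xd -skelE; case: mx => ->.
have [z zx zy] := Omega_of_face xy (leq_ltn_trans yd xd).
apply/hasP; exists z => //; apply/ml'; split; last first.
  by apply: maximal_on_skel; have := deg_bd zx; rewrite dx => -[].
by apply/hasP; exists x => //; apply: Omega_of_bd.
Qed.

Lemma skeleton_order_nil l r l' : g = l ++ r -> skeleton_order d l l' ->
  l = [::] <-> l' = [::].
Proof.
case: l => [|x l] gE ml'; split=> //.
  by case: l' ml' => [|y l'] // /(_ y) []; rewrite mem_head => /(_ isT)[].
move=> l'0; exfalso; suff [y xy yd] : exists2 y, Omega_of x y & deg y <= d.
  have := skeleton_order_Omega y gE ml'.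
  rewrite l'0 yd andbT => /esym/hasP[].
  by exists x; rewrite ?mem_head.
have [xd|xd] := leqP (deg x) d; first by exists x => //; apply: Omega_of_refl.
have dx : deg x = d.+1.
  apply/eqP; rewrite eqn_leq xd -skelE andbT; case: gS => _ _ [_ _ mg] _.
  by have [] : maximal_on (skel d.+1) x by apply/mg; rewrite gE mem_head.
have [h1 [h2 [_ mh _]]] := @top_bd_shelling [::] x (l ++ r) gE dx.
case: (h1 ++ h2) mh => // y h mh _.
by have [xy yd] := (mh y).1 (mem_head _ _); exists y; rewrite ?yd.
Qed.

(** Prefixes of [g] are the right induction: by [attaches_ext], what is required
    of a cell of the new list only involves the set of cells generated by those
    before it, and in degree at most [d] that set is known from the prefix. *)
Lemma skeleton_prefix l r : g = l ++ r -> exists l',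
  [/\ uniq l', skeleton_order d l l'
    & forall l1 x r1, l' = l1 ++ x :: r1 ->
        attaches (shelling_on (below x)) l1 x].
Proof.
have [d0 _ [_ ug mg] Sg] := gS.
elim/last_ind: l r => [|l x IHl] r gE.
  exists [::]; split=> //; last by case.
  by move=> y; split=> // -[].
rewrite cat_rcons in gE; have [l' [ul' ml' Sl']] := IHl _ gE.
have nl := skeleton_order_nil gE ml'.
have Ol y := skeleton_order_Omega y gE ml'.
have mx : maximal_on (skel d.+1) x.
  by apply/mg; rewrite gE mem_cat mem_head orbT.
have [xd|xd] := leqP (deg x) d.
  have mdx := maximal_on_skelS mx xd.
  exists (rcons l' x); split.
  - rewrite rcons_uniq ul' andbT; apply/negP=> /ml'[/hasP[z zl zx] _].
    have xz : x = z.
      apply: (maximal_on_Omega_of zx) mx; rewrite -skelE.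
      by have [] : maximal_on (skel d.+1) z by apply/mg; rewrite gE mem_cat zl.
    move: ug; rewrite gE cat_uniq => /and3P[_ /hasPn/(_ x (mem_head _ _)) + _].
    by rewrite /= xz zl.
  - move=> y; rewrite mem_rcons inE Omega_of_seq_rcons.
    split=> [/predU1P[->|/ml'[-> my]]|[/orP[ly|xy] my]] //.
    - by rewrite Omega_of_refl orbT.
    - by apply/orP; right; apply/ml'.
    - by rewrite (maximal_on_Omega_of xy xd my) eqxx.
  move=> l1 z r1; case/lastP: r1 => [|r1 z'].
    rewrite cats1 => /rcons_inj[<- <-].
    apply: attaches_ext nl _ (Sg _ _ _ gE) => y; rewrite !meet_cellsE Ol.
    have [xy|//] := boolP (Omega_of x y).
    by rewrite (leq_trans (Omega_of_deg xy) xd) andbT.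
  by rewrite -rcons_cons -rcons_cat => /rcons_inj[/Sl'].
have dx : deg x = d.+1 by apply/eqP; rewrite eqn_leq xd -skelE; case: mx => ->.
have [h1 [h2 [hS mh mh1 h_neq0]]] := top_bd_shelling gE dx.
have [dh _ [_ uh _] Sh] := hS.
have mh2 y : y \in h2 -> Omega_of x y /\ deg y = d.
  by move=> yh2; apply/mh; rewrite mem_cat yh2 orbT.
have pl : l <> [::] -> pure_on (meet_cells x l) d.
  by have := Sg _ _ _ gE; rewrite /attaches dx => /(_ isT)[].
exists (l' ++ h2); split.
- rewrite cat_uniq ul'; move: uh; rewrite cat_uniq => /and3P[_ h12 ->].
  rewrite andbT; apply: contraNN h12 => /hasP[y yh2 /ml'[ly _]].
  apply/hasP; exists y => //; apply/mh1.
  have [xy yd] := mh2 y yh2.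
  by rewrite meet_cellsE xy ly.
- move=> y; rewrite mem_cat Omega_of_seq_rcons.
  split=> [/orP[/ml'[-> my]|yh2] //|[/orP[ly|xy] my]].
  - have [xy yd] := mh2 y yh2.
    by rewrite xy orbT; split=> //; apply: maximal_on_skel.
  - by apply/orP; left; apply/ml'.
  have yd : deg y = d.
    have [yd my'] := my; apply: (Omega_of_uncovered_deg xy dx yd) => f _ fd.
    exact: my'.
  have : y \in h1 ++ h2 by apply/mh.
  rewrite mem_cat => /orP[/mh1[_ /andP[_ ly]]|->]; last by rewrite orbT.
  by apply/orP; left; apply/ml'.
(* Purity of the intersection of [x] with [l] is used here: that intersection
   is generated by [h1]. *)
have mxE y :
    Omega_of x y -> deg y <= d -> Omega_of_seq h1 y = Omega_of_seq l' y.
  move=> xy yd; rewrite Ol yd andbT; apply/idP/idP=> [/hasP[z zh1 zy]|ly].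
    have [_ /andP[_ lz]] := (mh1 z).1 zh1.
    exact: closed_Omega_of_seq lz zy.
  have l_neq0 : l <> [::] by move=> l0; rewrite l0 in ly.
  have my : meet_cells x l y by rewrite meet_cellsE xy.
  have [z mz [dz zy]] := pure_on_top (pl l_neq0) my.
  by apply/hasP; exists z => //; apply/mh1.
(* If [l] is nonempty, then so is [h1], as a pure complex of order [d] has a
   cell of degree [d]. *)
have nh1 : h1 = [::] <-> l' = [::].
  apply: iff_trans nl; split=> [h10|l0].
    apply/eqP; apply: contraT => /eqP/pl[[_ [y my yd]] _].
    by have : y \in h1 by [apply/mh1]; rewrite h10.
  case h1E: h1 => [//|y h]; have [_] : deg y = d /\ meet_cells x l y.
    by apply/mh1; rewrite h1E mem_head.
  by rewrite l0 meet_cellsE andbF.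
move=> l1 z r1 lE; have [[r1' /Sl'//]|[m -> h2E]] := cat_eq_cat_cons lE.
have Az : attaches (shelling_on (below z)) (h1 ++ m) z.
  by apply: (Sh _ _ r1); rewrite h2E catA.
have /mh[xz zd] : z \in h1 ++ h2 by rewrite h2E !mem_cat mem_head !orbT.
apply: attaches_ext Az => [|y].
  case: m {h2E} => [|y m]; first by rewrite !cats0.
  by split=> /(congr1 size)/eqP; rewrite size_cat addnS.
rewrite !meet_cellsE !Omega_of_seq_cat.
have [zy|//] := boolP (Omega_of z y); rewrite mxE //.
  exact: Omega_of_trans xz zy.
by rewrite -zd; apply: Omega_of_deg.
Qed.

Lemma shelling_skelS :
  order_on (skel d) d /\ exists h, shelling_on (skel d) h.
Proof.
have [_ _ [_ _ mg] _] := gS.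
have topP x : deg x = d.+1 -> exists l r, g = l ++ x :: r.
  move=> dx; have /splitPr[l r] : x \in g by apply/mg/maximal_on_skel.
  by exists l, r.
have [_ [x _ dx]] := og.
have od : order_on (skel d) d.
  split=> //; have [l [r gE]] := topP x dx.
  have [h1 [h2 [_ mh _]]] := top_bd_shelling gE dx.
  case: (h1 ++ h2) mh => // y h mh _.
  by have [_ yd] := (mh y).1 (mem_head _ _); exists y; rewrite ?skelE ?yd.
split=> //; have [h [uh mh Sh]] := @skeleton_prefix g [::] (esym (cats0 _)).
exists h; apply: (ShellingOn od) => //; split=> //.
  move=> h0; have [l [r gE]] := topP x dx.
  have [_ /(_ h0)] := skeleton_order_nil (esym (cats0 _)) mh.
  by rewrite gE; case: (l).
move=> y; split=> [/mh[]//|my]; apply/mh; split=> //.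
have yg : maximal_on (skel d.+1) y -> Omega_of_seq g y.
  by move/mg; apply: Omega_of_seq_mem.
have [yd my'] := my; rewrite skelE leq_eqVlt in yd.
case/predU1P: yd => yd; last first.
  apply: yg; split=> [|f]; first exact: leqW (ltnW yd).
  move=> _; apply/negP=> yf; have := my' f.
  by rewrite skelE (deg_bd yf) yf => /(_ yd).
(* A cell of degree [d] need not have a coface; if it has none, it is already
   listed in [g]. *)
have [/existsP[b yb]|/existsPn nb] :=
    boolP [exists b : basis C d.+1, y \in bd (mk_cell b)].
  apply/hasP; exists (mk_cell b); last exact: Omega_of_bd.
  by apply/mg/maximal_on_skel.
apply: yg; split=> [|f _]; first by rewrite skelE yd.
apply/negP=> yf; have := deg_bd yf; rewrite yd.
case: f yf => n b yb; rewrite /deg /= => nd; subst n.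
by have /negP[] := nb b.
Qed.

End Step.

End Skeleton.

Theorem corollary5p10 (R : idomainType) (hR : principal_ring R)
    (C : chain_complex R) (d : nat) (hd : has_order C d) (hC : shellable C)
    (i : nat) (hi : (i <= d)%N) :
  shellable (sk C i).
Proof.
have oC := (embeds_order (embeds_id (C := C) (T := predT) (fun=> isT)) d).1 hd.
have idC : embeds id (@skel_cells R C d).
  by apply: embeds_id => e; case: oC => + _; apply.
have top : order_on (@skel_cells R C d) d
    /\ exists h, shelling_on (@skel_cells R C d) h.
  split; first exact/(embeds_order idC).
  have [g gS] := hC; exists g; rewrite -[g]map_id.
  exact/(embeds_shelling g idC).
(* Descend from the [d]-skeleton, which is [C] itself. *)
have [_ [h hS]] : order_on (@skel_cells R C i) i
    /\ exists h, shelling_on (@skel_cells R C i) h.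
  rewrite -(subKn hi); elim: (d - i) => [|k IHk]; first by rewrite subn0.
  have [kd|dk] := ltnP k d; last first.
    by rewrite (eqP (leqW dk : d - k.+1 == 0)) -(eqP (dk : d - k == 0)).
  rewrite -(subnSK kd) in IHk; have [ok [h hS]] := IHk.
  exact: shelling_skelS ok hS.
have isk := embeds_sub_cell (@closed_skel_cells R C i).
have [|g hE] := embeds_lift isk (s := h).
  by case: hS => _ _ [_ _ mh] _ y /mh[].
by exists g; apply/(embeds_shelling g isk); rewrite -hE.
Qed.
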